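(* If $G$ and $H$ are graphs and $f:V(G)\to V(H)$ is a function, then $$M(G\otimes_f H;x,y)=M^{(\mathrm{inner})}(x,y)+M^{(\mathrm{conn})}(x,y),$$ where $$M^{(\mathrm{inner})}(x,y)=\sum_{g\in V(G)}\ \sum_{\{h,h'\}\in E(H)} x^{\min\{d_{g,h},\,d_{g,h'}\}}\,y^{\max\{d_{g,h},\,d_{g,h'}\}},$$ $$M^{(\mathrm{conn})}(x,y)=\sum_{\{g,g'\}\in E(G)} x^{\min\{d_{g,f(g')},\,d_{g',f(g)}\}}\,y^{\max\{d_{g,f(g')},\,d_{g',f(g)}\}},$$ and $d_{u,v}=\deg_{G\otimes_f H}(u,v)$ for all $(u,v)\in V(G\otimes_f H)$.
   Context: All graphs are finite, simple, and undirected; $\deg_G(g)$ is the degree of $g$ in $G$. For $i\le j$ let $m_{i,j}(G)=|\{\{g,g'\}\in E(G): \{\deg_G(g),\deg_G(g')\}=\{i,j\}\}|$. The M-polynomial of $G$ is $M(G;x,y)=\sum_{i\le j} m_{i,j}(G)\,x^iy^j$. For $f:V(G)\to V(H)$, the Sierpiński product $G\otimes_f H$ has vertex set $V(G)\times V(H)$ and the following two types of edges: inner edges $(g,h)(g,h')$ for every $g\in V(G)$ and every $hh'\in E(H)$; and connecting edges $(g,f(g'))(g',f(g))$ for every $gg'\in E(G)$. Degrees in it are given by $\deg_{G\otimes_f H}(g,h)=\deg_H(h)+|\{g'\in N_G(g): f(g')=h\}|$, where $N_G(g)$ is the open neighborhood of $g$ in $G$. *)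

(* Defs.v *)
From mathcomp Require Import all_boot all_order all_algebra.
From mathcomp Require Import mpoly.

Set Implicit Arguments.
Unset Strict Implicit.
Unset Printing Implicit Defensive.

Import GRing.Theory.
Local Open Scope ring_scope.

Record sgraph := SGraph {
  vertex :> finType;
  adj : rel vertex;
  adj_sym : ssrbool.symmetric adj;
  adj_irrefl : irreflexive adj }.

Definition nbhd (G : sgraph) (g : G) : {set G} := [set g' | adj g g'].

Definition gdeg (G : sgraph) (g : G) : nat := #|nbhd g|.

Definition edges (G : sgraph) : {set {set G}} :=
  [set [set p.1; p.2] | p in [set p : G * G | adj p.1 p.2]].

(* The value at the unordered pair e = {g, g'} of an expression F g g' that is
   symmetric in g and g'. The endpoints are labelled arbitrarily; by [on_edgeE]
   the labelling does not matter for symmetric F. *)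
Definition on_edge (R : nmodType) (G : sgraph) (F : G -> G -> R)
    (e : {set G}) : R :=
  if [pick p : G * G | e == [set p.1; p.2]] is Some p then F p.1 p.2 else 0.

Lemma on_edgeE (R : nmodType) (G : sgraph) (F : G -> G -> R) (g g' : G) :
  (forall a b, F a b = F b a) -> on_edge F [set g; g'] = F g g'.
Proof.
move=> Fsym; rewrite /on_edge.
case: pickP => [[a b] /= /eqP E | /(_ (g, g'))/=].
  have := set21 a b; have := set22 a b; rewrite -E !in_set2.
  have := set21 g g'; have := set22 g g'; rewrite E !in_set2.
  by do 4!case/orP => /eqP ?; subst.
by rewrite eqxx.
Qed.

(* The number of edges whose unordered pair of end degrees is {i, j}. *)
Definition mcount (G : sgraph) (i j : nat) : nat :=
  #|[set e in edges G | [exists g, exists g',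
      (e == [set g; g']) &&
      (((gdeg g == i) && (gdeg g' == j)) ||
       ((gdeg g == j) && (gdeg g' == i)))]]|.

Definition varx : {mpoly int[2]} := 'X_ord0.
Definition vary : {mpoly int[2]} := 'X_ord_max.

(* All degrees are < #|G|, so the sum over all i <= j is finite with these
   bounds. *)
Definition Mpoly (G : sgraph) : {mpoly int[2]} :=
  \sum_(0 <= i < #|G|) \sum_(i <= j < #|G|)
    (varx ^+ i * vary ^+ j) *+ mcount G i j.

Section SierpinskiProduct.

Variables (G H : sgraph) (f : G -> H).

Definition sierp_adj : rel (G * H) := fun u v =>
  ((u.1 == v.1) && adj u.2 v.2) ||
  [&& adj u.1 v.1, u.2 == f v.1 & v.2 == f u.1].

Lemma sierp_adj_sym : ssrbool.symmetric sierp_adj.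
Proof.
move=> u v; rewrite /sierp_adj eq_sym (adj_sym u.2) (adj_sym u.1).
by rewrite (andbC (u.2 == _)).
Qed.

Lemma sierp_adj_irrefl : irreflexive sierp_adj.
Proof. by move=> u; rewrite /sierp_adj !adj_irrefl andbF. Qed.

Definition sierpinski : sgraph := SGraph sierp_adj_sym sierp_adj_irrefl.

Definition sierp_deg (g : G) (h : H) : nat := gdeg ((g, h) : sierpinski).

Definition Mpoly_inner : {mpoly int[2]} :=
  \sum_(g : G) \sum_(e in edges H)
    on_edge (fun h h' : H =>
      varx ^+ minn (sierp_deg g h) (sierp_deg g h') *
      vary ^+ maxn (sierp_deg g h) (sierp_deg g h')) e.

Definition Mpoly_conn : {mpoly int[2]} :=
  \sum_(e in edges G)
    on_edge (fun g g' : G =>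
      varx ^+ minn (sierp_deg g (f g')) (sierp_deg g' (f g)) *
      vary ^+ maxn (sierp_deg g (f g')) (sierp_deg g' (f g))) e.

End SierpinskiProduct.

(* Main.v *)
Require Import Defs.
From mathcomp Require Import all_boot all_order all_algebra.
From mathcomp Require Import mpoly.
From mathcomp Require Import zify.
Local Open Scope ring_scope.

(** Grouping the edges of a graph by their end degrees turns the M-polynomial
    into a sum of [x^min * y^max] over the edges. An edge of the Sierpiński
    product either has both ends in one fibre [{g} x H], or joins two distinct
    fibres; the former are the copies [{g} x e] of edges [e] of [H], the latter
    correspond bijectively to the edges of [G], which are recovered by
    projecting to the first coordinate. *)

Definition degree_monomial (i j : nat) : {mpoly int[2]} :=
  varx ^+ minn i j * vary ^+ maxn i j.

Lemma degree_monomialC i j : degree_monomial i j = degree_monomial j i.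
Proof. by rewrite /degree_monomial minnC maxnC. Qed.

Lemma edgesP (G : sgraph) (e : {set G}) :
  reflect (exists g g', adj g g' /\ e = [set g; g']) (e \in edges G).
Proof.
apply: (iffP imsetP) => [[[a b]]|[a [b [ab ->]]]].
  by rewrite inE /= => ab ->; exists a, b.
by exists (a, b) => //; rewrite inE.
Qed.

Lemma eq_set2 (T : finType) (a b c d : T) :
  [set a; b] = [set c; d] -> (a = c /\ b = d) \/ (a = d /\ b = c).
Proof.
move=> E.
(* Either pair may be degenerate, so memberships are needed in both directions. *)
have := set21 a b; have := set22 a b; rewrite E !in_set2.
have := set21 c d; have := set22 c d; rewrite -E !in_set2.
by do 4!case/orP => /eqP ?; subst; auto.
Qed.

Lemma gdeg_lt_card (G : sgraph) (g : G) : (gdeg g < #|G|)%N.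
Proof.
apply: proper_card; apply/properP; split; first exact/subsetP.
by exists g; rewrite // inE adj_irrefl.
Qed.

(** An ordered pair [i <= j] is determined by its minimum and maximum, so each edge is counted by
    exactly one [mcount G i j] with [i <= j]. *)
Lemma degree_pairE (G : sgraph) (a b : G) (i j : nat) : (i <= j)%N ->
  [exists g, exists g', ([set a; b] == [set g; g']) &&
      (((gdeg g == i) && (gdeg g' == j)) ||
       ((gdeg g == j) && (gdeg g' == i)))] =
  (i == minn (gdeg a) (gdeg b)) && (j == maxn (gdeg a) (gdeg b)).
Proof.
move=> le_ij; apply/existsP/idP => [[g /existsP[g' /andP[/eqP/eq_set2]]]|Eij].
  by case=> [][-> ->]; lia.
by exists a; apply/existsP; exists b; rewrite eqxx /=; lia.
Qed.

(** Double counting: each [mcount] becomes a sum of indicators over the edges, and after exchanging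
    the sums each edge selects a single exponent pair. *)
Lemma Mpoly_edges (G : sgraph) :
  Mpoly G =
  \sum_(e in edges G) on_edge (fun a b => degree_monomial (gdeg a) (gdeg b)) e.
Proof.
pose D i j (e : {set G}) := [exists g, exists g', (e == [set g; g']) &&
  (((gdeg g == i) && (gdeg g' == j)) || ((gdeg g == j) && (gdeg g' == i)))].
transitivity (\sum_(0 <= i < #|G|) \sum_(i <= j < #|G|) \sum_(e in edges G)
    (if D i j e then varx ^+ i * vary ^+ j else 0)).
  apply: eq_bigr => i _; apply: eq_bigr => j _.
  rewrite -big_mkcondr GRing.sumr_const /mcount.
  by congr (_ *+ _); apply: eq_card => e; rewrite !inE.
under eq_bigr do rewrite exchange_big.
rewrite exchange_big; apply: eq_bigr => e /edgesP[a [b [_ ->]]].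
rewrite on_edgeE; last by move=> *; exact: degree_monomialC.
set p := minn (gdeg a) (gdeg b); set q := maxn (gdeg a) (gdeg b).
(* These bounds put [(p, q)] inside the summation range, so its term is not lost. *)
have ltq : (q < #|G|)%N by rewrite gtn_max !gdeg_lt_card.
have lepq : (p <= q)%N by rewrite /p /q; lia.
transitivity (\sum_(0 <= i < #|G| | i == p) \sum_(i <= j < #|G| | j == q)
    (varx ^+ i * vary ^+ j)).
  rewrite [RHS]big_mkcond; apply: eq_big_nat => i _.
  transitivity (\sum_(i <= j < #|G|)
      (if (i == p) && (j == q) then varx ^+ i * vary ^+ j else 0)).
    by apply: eq_big_nat => j /andP[le_ij _]; rewrite /D degree_pairE.
  by case: (i == p); [rewrite [RHS]big_mkcond|rewrite big1].
by rewrite big_nat1_eq leq0n (leq_ltn_trans lepq ltq) /= big_nat1_eq lepq ltq.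
Qed.

Section SierpinskiEdges.

Variables (G H : sgraph) (f : G -> H).

Definition inner_edge (p : G * {set H}) : {set sierpinski f} :=
  [set (p.1, h) | h in p.2].

(** Ranging over both orientations of [e] avoids choosing a labelling of its ends. *)
Definition conn_edge (e : {set G}) : {set sierpinski f} :=
  [set ((p.1, f p.2) : sierpinski f)
    | p in [set p : G * G | [&& p.1 \in e, p.2 \in e & p.1 != p.2]]].

Lemma inner_edge2 g h h' :
  inner_edge (g, [set h; h']) = [set ((g, h) : sierpinski f); (g, h')].
Proof. by rewrite /inner_edge /= imsetU1 imset_set1. Qed.

Lemma conn_edge2 g g' : adj g g' ->
  conn_edge [set g; g'] = [set ((g, f g') : sierpinski f); (g', f g)].
Proof.
(* If [g = g'], the index set in [conn_edge] would be empty. *)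
move=> gg'; have ne : g != g'.
  by apply: contraTneq gg' => ->; rewrite adj_irrefl.
apply/setP => u; rewrite in_set2; apply/imsetP/orP => [[[a b]]|].
  rewrite !inE /= => /and3P[/orP[]/eqP-> /orP[]/eqP->] //; rewrite ?eqxx // => _ ->.
    by left.
  by right.
case=> /eqP->.
  by exists (g, g') => //; rewrite !inE /= !eqxx orbT.
by exists (g', g) => //; rewrite !inE /= !eqxx orbT /= eq_sym.
Qed.

(** The restriction to edges matters: the empty set has the same image in every fibre. *)
Lemma inner_edge_inj :
  {in [pred p | p.2 \in edges H] &, injective inner_edge}.
Proof.
move=> [g e] [g' e'] /=; rewrite !inE /= => /edgesP[a [b [_ ->]]].
move=> /edgesP[c [d [_ ->]]]; rewrite !inner_edge2 => /eq_set2.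
by case=> [][[-> ->] [->]] //; rewrite setUC.
Qed.

Lemma conn_edge_inj : {in edges G &, injective conn_edge}.
Proof.
move=> e e' /edgesP[a [b [ab ->]]] /edgesP[c [d [cd ->]]].
rewrite !conn_edge2 // => /eq_set2.
by case=> [][/(congr1 fst)/= -> /(congr1 fst)/= ->] //; rewrite setUC.
Qed.

Lemma edges_sierpinski :
  edges (sierpinski f) =
    inner_edge @: [set p | p.2 \in edges H] :|: conn_edge @: edges G.
Proof.
apply/setP => e; rewrite in_setU; apply/edgesP/orP.
  case=> -[g h] [[g' h'] [/orP[/andP[/= /eqP <- hh']|]]].
    move=> ->; left; rewrite -inner_edge2; apply: imset_f; rewrite inE.
    by apply/edgesP; exists h, h'.
  case/and3P=> /= gg' /eqP-> /eqP-> ->; right; rewrite -conn_edge2 //.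
  by apply: imset_f; apply/edgesP; exists g, g'.
case=> /imsetP.
  case=> -[g e']; rewrite inE => /edgesP[h [h' [hh' /= ->]]] ->.
  exists (g, h), (g, h'); split; last exact: inner_edge2.
  by rewrite /= /sierp_adj /= eqxx hh'.
case=> e' /edgesP[g [g' [gg' ->]]] ->.
exists (g, f g'), (g', f g); split; last exact: conn_edge2.
by rewrite /= /sierp_adj /= gg' !eqxx orbT.
Qed.

Lemma disjoint_inner_conn :
  [disjoint inner_edge @: [set p | p.2 \in edges H] & conn_edge @: edges G].
Proof.
apply/pred0P => e /=; apply/negP => /andP[/imsetP[[g e1]]].
rewrite inE => /edgesP[h [h' [_ /= ->]]] -> /imsetP[e2].
move=> /edgesP[a [b [ab ->]]]; rewrite inner_edge2 conn_edge2 // => /eq_set2.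
(* Both ends lie over [g], so [a] and [b] both equal [g], against irreflexivity. *)
by case=> [][/(congr1 fst)/= ga /(congr1 fst)/= gb]; move: ab;
  rewrite -ga -gb adj_irrefl.
Qed.

End SierpinskiEdges.

Theorem theorem3p10 (G H : sgraph) (f : G -> H) :
  Mpoly (sierpinski f) = Mpoly_inner f + Mpoly_conn f.
Proof.
rewrite Mpoly_edges edges_sierpinski (eq_bigl _ _ (fun e => in_setU e _ _)) bigU /=;
  last exact: disjoint_inner_conn.
congr (_ + _).
  (* Injectivity lets each sum be reindexed by its source edges; symmetry of the monomial then makes
     the labelling chosen by [on_edge] irrelevant. *)
  rewrite big_imset /=; last first.
    by move=> p q; rewrite !inE; exact: inner_edge_inj.
  rewrite /Mpoly_inner pair_big_dep /=.
  apply: eq_big => [[g e]|[g e]]; rewrite inE //= => /edgesP[h [h' [_ ->]]].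
  rewrite inner_edge2 !on_edgeE // => *; exact: degree_monomialC.
rewrite big_imset; last exact: conn_edge_inj.
apply: eq_bigr => e /edgesP[g [g' [gg' ->]]].
rewrite conn_edge2 // !on_edgeE // => *; exact: degree_monomialC.
Qed.
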